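(* Let $n$ be a natural number, let $a_1,\dots,a_n$ be natural numbers (positive integers), and let $b$ be a non-negative integer. Put $l'_0=1$ and, for $k=1,2,\dots,\sum_{i=1}^{n}a_i-n$, $$l'_k=\binom{n-1+k}{n-1}-\sum_{i=1}^{n}\overline{C}^{\,n-1}_{n-1+k-a_i}+\sum_{1\le i<j\le n}\overline{C}^{\,n-1}_{n-1+k-a_i-a_j}-\sum_{1\le i<j<m\le n}\overline{C}^{\,n-1}_{n-1+k-a_i-a_j-a_m}+\cdots+(-1)^n\,\overline{C}^{\,n-1}_{n-1+k-\sum_{i=1}^{n}a_i},$$ i.e. $l'_k=\sum_{S\subseteq\{1,\dots,n\}}(-1)^{|S|}\,\overline{C}^{\,n-1}_{n-1+k-\sum_{i\in S}a_i}$. Then $$\sum_{k=0}^{a_1+a_2+\cdots+a_n-n}l'_k\,P(b-k)=\binom{b+n-1}{n-1}.$$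
   Context: For an integer $l$, $P(l)$ denotes the number of $n$-tuples $(x_1,\dots,x_n)$ of non-negative integers with $\sum_{i=1}^n a_ix_i=l$ (so $P(l)=0$ for $l<0$). For integers $k$ and $m\ge 0$, $\overline{C}^{\,m}_k$ equals the binomial coefficient $\binom{k}{m}$ if $k\ge m$, and $0$ otherwise. *)

(* Defs.v *)
From mathcomp Require Import all_boot all_order all_algebra.
From mathcomp Require Import finmap boolp classical_sets cardinality.

Set Implicit Arguments.
Unset Strict Implicit.
Unset Printing Implicit Defensive.

Import GRing.Theory Num.Theory.

Local Open Scope ring_scope.

(* The counted set is finite as soon as every [a i] is positive; [fset_set] of
   an infinite set would be the empty [fset]. *)
Definition P (n : nat) (a : 'I_n -> nat) (l : int) : nat :=
  #|` fset_set [set x : n.-tuple nat |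
                 (\sum_(i < n) a i * tnth x i)%N%:Z = l]%classic |%fset.

(* The upper index [k] may be negative, hence [int]: for [m = 0] truncated
   subtraction on [nat] would turn a value 0 into 1. *)
Definition Cbar (m : nat) (k : int) : int :=
  if m%:Z <= k then 'C(`|k|%N, m)%:Z else 0.

Definition l' (n : nat) (a : 'I_n -> nat) (k : nat) : int :=
  if k == 0%N then 1 else
  \sum_(S : {set 'I_n})
    (-1) ^+ #|S| * Cbar n.-1 (n.-1%:Z + k%:Z - (\sum_(i in S) a i)%N%:Z).

(* Main.v *)
Require Import Defs.
From mathcomp Require Import all_boot all_order all_algebra.
From mathcomp Require Import finmap boolp classical_sets cardinality.
From mathcomp Require Import zify.

Set Implicit Arguments.
Unset Strict Implicit.
Unset Printing Implicit Defensive.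

Import GRing.Theory Num.Theory.

Local Open Scope ring_scope.

(** In terms of formal power series in a variable X, P is the coefficient
    sequence of the product over i of 1 / (1 - X^(a i)), and l' is that of the
    product over i of
      (1 - X^(a i)) / (1 - X) = 1 + X + ... + X^(a i - 1),
    since expanding the product of the 1 - X^(a i) over subsets S produces the
    alternating sum, and the coefficients of 1 / (1 - X)^n are the binomial
    coefficients (stars and bars). The second product is a polynomial of degree
    at most (\sum_i a i) - n, which is the summation bound of the theorem.
    Multiplying the two products leaves 1 / (1 - X)^n, and the theorem compares
    the coefficients of X^b.

    Power series are replaced by integer polynomials compared modulo X^N, with
    1 / (1 - q) replaced by the truncated geometric sum of the q^j for j < N.
    [l'E] and [P_nat] identify the two coefficient sequences,
    [geomX_mul_geomXn_mod] is the cancellation in one variable,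
    and [coef_geomX_exp] computes the powers of the geometric sum. *)

Definition geom (R : pzRingType) (q : R) (N : nat) : R := \sum_(j < N) q ^+ j.

Lemma sub1_mul_geom (R : pzRingType) (q : R) (N : nat) :
  (1 - q) * geom q N = 1 - q ^+ N.
Proof. by rewrite -[LHS]opprK -mulNr opprB -subrX1 opprB. Qed.

Definition eq_modXn (R : nzRingType) (N : nat) (p q : {poly R}) : Prop :=
  forall k, (k < N)%N -> p`_k = q`_k.

Lemma eq_modXnM (R : nzRingType) (N : nat) (p p' q q' : {poly R}) :
  eq_modXn N p p' -> eq_modXn N q q' -> eq_modXn N (p * q) (p' * q').
Proof.
move=> pp' qq' k lt_kN; rewrite !coefM; apply: eq_bigr => -[i le_ik] _ /=.
by rewrite pp' ?qq' //; lia.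
Qed.

Lemma eq_modXn_prod (R : nzRingType) (N : nat) (I : Type) (r : seq I)
    (P : pred I) (F G : I -> {poly R}) :
  (forall i, P i -> eq_modXn N (F i) (G i)) ->
  eq_modXn N (\prod_(i <- r | P i) F i) (\prod_(i <- r | P i) G i).
Proof. by move=> FG; elim/big_rec2: _ => // i p q Pi; apply/eq_modXnM/FG. Qed.

Lemma coef_geomX (R : nzRingType) (N k : nat) :
  (geom ('X : {poly R}) N)`_k = (k < N)%N%:R.
Proof.
rewrite /geom coef_sum.
under eq_bigr do rewrite coefXn.
have [lt_kN|le_Nk] := ltnP k N.
  rewrite (bigD1 (Ordinal lt_kN)) //= eqxx big1 ?addr0 // => i.
  by rewrite -val_eqE /= eq_sym => /negPf->.
by rewrite big1 // => i _; rewrite gtn_eqF // (leq_trans (ltn_ord i)).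
Qed.

Lemma size_geomX (R : nzRingType) (N : nat) :
  (size (geom ('X : {poly R}) N) <= N)%N.
Proof. by apply/leq_sizeP => k le_Nk; rewrite coef_geomX ltnNge le_Nk. Qed.

(** Every j < c * N is uniquely r + c * q with r < c and q < N; algebraically,
    multiplying either side by 1 - X telescopes it to 1 - X^(c * N). *)
Lemma geomX_mul_geomXn (R : idomainType) (c N : nat) :
  geom ('X : {poly R}) c * geom 'X^c N = geom 'X (c * N).
Proof.
have X1_neq0 : 1 - 'X != 0 :> {poly R} by rewrite -oppr_eq0 opprB polyXsubC_eq0.
by apply: (mulfI X1_neq0); rewrite mulrA !sub1_mul_geom exprM.
Qed.

(** The truncated form of (1 - X^c) / (1 - X) * 1 / (1 - X^c) = 1 / (1 - X). *)
Lemma geomX_mul_geomXn_mod (R : idomainType) (c N : nat) : (0 < c)%N ->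
  eq_modXn N (geom ('X : {poly R}) c * geom 'X^c N) (geom 'X N).
Proof.
move=> c_gt0 k lt_kN; rewrite geomX_mul_geomXn !coef_geomX lt_kN.
by rewrite (leq_trans lt_kN) // leq_pmull.
Qed.

Lemma sum_binD (m k : nat) : \sum_(j < k.+1) 'C(m + j, m) = 'C(m.+1 + k, m.+1).
Proof.
elim: k => [|k IHk]; first by rewrite big_ord1 !addn0 !binn.
by rewrite big_ord_recr /= IHk !addSn addnS binS.
Qed.

(** Stars and bars: multiplying by the geometric sum takes partial sums of the
    coefficients, so the hockey-stick identity [sum_binD] drives an induction. *)
Lemma coef_geomX_exp (R : nzRingType) (N m k : nat) : (k < N)%N ->
  (geom ('X : {poly R}) N ^+ m.+1)`_k = 'C(m + k, m)%:R.
Proof.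
elim: m k => [|m IHm] k lt_kN; first by rewrite coef_geomX lt_kN bin0.
rewrite exprSr coefM -sum_binD natr_sum; apply: eq_bigr => -[j le_jk] _ /=.
have [lt_jN lt_kjN] : (j < N)%N /\ (k - j < N)%N by lia.
by rewrite IHm // coef_geomX lt_kjN mulr1.
Qed.

Lemma prod_1subXn (R : comNzRingType) (n : nat) (a : 'I_n -> nat) :
  \prod_(i < n) (1 - 'X^(a i)) =
  \sum_(S : {set 'I_n}) (-1) ^+ #|S| * 'X^(\sum_(i in S) a i) :> {poly R}.
Proof.
under eq_bigr do rewrite addrC.
rewrite bigA_distr; apply: eq_bigr => S _.
rewrite -big_mkcond /=.
under eq_bigr do rewrite -mulN1r.
by rewrite big_split /= prodr_const expr_sum.
Qed.

(** Written this way, [Cbar] at the index occurring in [l'] is the coefficient of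
    X^k in X^s / (1 - X)^(m + 1). *)
Lemma CbarE (m k s : nat) :
  Cbar m (m%:Z + k%:Z - s%:Z) = if (k < s)%N then 0 else 'C(m + (k - s), m)%:Z.
Proof.
rewrite /Cbar; have [lt_ks|le_sk] := ltnP k s.
  by rewrite ifF //; lia.
rewrite ifT; last by lia.
by congr (Posz 'C(_, _)); lia.
Qed.

(** Each factor 1 + ... + X^(a i - 1) agrees with (1 - X^(a i)) / (1 - X) modulo
    X^(k + 1); the alternating sum is the expansion of the product of these
    fractions. *)
Lemma sum_CbarE (m : nat) (a : 'I_m.+1 -> nat) (k : nat) :
  \sum_(S : {set 'I_m.+1})
    (-1) ^+ #|S| * Cbar m (m%:Z + k%:Z - (\sum_(i in S) a i)%N%:Z)
  = (\prod_i geom ('X : {poly int}) (a i))`_k.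
Proof.
pose U := geom ('X : {poly int}) k.+1.
have geom_frac i : eq_modXn k.+1 (geom ('X : {poly int}) (a i))
                            ((1 - 'X^(a i)) * U).
  have -> : (1 - 'X^(a i)) * U = geom 'X (a i) * (1 - 'X^(k.+1)).
    by rewrite -sub1_mul_geom mulrAC sub1_mul_geom mulrC.
  by move=> j lt_jk; rewrite mulrBr mulr1 coefB coefMXn lt_jk subr0.
rewrite (@eq_modXn_prod _ k.+1 _ _ _ _ _ (fun i _ => geom_frac i)) //.
rewrite big_split /= prodr_const card_ord prod_1subXn mulr_suml coef_sum.
apply: eq_bigr => S _; rewrite CbarE -mulrA.
(* The sign must be seen as a constant polynomial for [coefCM] to apply. *)
rewrite -[-1 in RHS]/(- 1%:P) -polyCN -polyC_exp coefCM coefXnM.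
by case: ltnP => // _; rewrite coef_geomX_exp ?natz //; lia.
Qed.

(** The value 1 set apart at k = 0 is the constant coefficient, because every
    factor contains the term X^0 when a i > 0. *)
Lemma l'E (n : nat) (a : 'I_n -> nat) (k : nat) :
  (0 < n)%N -> (forall i, 0 < a i)%N ->
  l' a k = (\prod_i geom ('X : {poly int}) (a i))`_k.
Proof.
case: n a => // m a _ a_gt0; rewrite /l'; case: eqP => [->|_]; last first.
  exact: sum_CbarE.
by rewrite coef0_prod big1 // => i _; rewrite coef_geomX a_gt0.
Qed.

Lemma size_prod_geomX (n : nat) (a : 'I_n -> nat) :
  (forall i, 0 < a i)%N ->
  (size (\prod_i geom ('X : {poly int}) (a i))%R <= (\sum_i a i - n).+1)%N.
Proof.
move=> a_gt0; apply: leq_trans (size_prod_leq _ _) _.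
have le_n : (n <= \sum_i a i)%N.
  rewrite -[n in (n <= _)%N]card_ord -sum1_card; apply: leq_sum => i _.
  exact: a_gt0.
rewrite card_ord -subSn // leq_sub2r // ltnS.
by apply: leq_sum => i _; apply: size_geomX.
Qed.

Lemma P_neg (n : nat) (a : 'I_n -> nat) (l : int) : l < 0 -> P a l = 0%N.
Proof.
move=> l_lt0; rewrite /P (_ : [set x | _]%classic = set0) ?fset_set0 //.
by apply/seteqP; split => x //= eq_l; move: l_lt0; rewrite -eq_l.
Qed.

(** Expanding the product chooses one exponent f i < N for each i. This bound
    loses no solution of \sum_i a i * x i = l, since a i > 0 forces x i <= l < N;
    the same bound makes the set counted by [P] finite. *)
Lemma P_nat (n : nat) (a : 'I_n -> nat) (N l : nat) :
  (forall i, 0 < a i)%N -> (l < N)%N ->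
  (P a l%:Z)%:R = (\prod_i geom ('X^(a i) : {poly int}) N)`_l.
Proof.
move=> a_gt0 lt_lN.
pose tup (f : {ffun 'I_n -> 'I_N}) : n.-tuple nat := [tuple val (f i) | i < n].
have tup_inj : injective tup.
  move=> f g eq_fg; apply/ffunP => i; apply: val_inj.
  by move/(congr1 (fun t => tnth t i)): eq_fg; rewrite !tnth_mktuple.
pose A := [set f : {ffun 'I_n -> 'I_N} | \sum_i a i * f i == l]%N.
have -> : P a l%:Z = #|A|.
  rewrite /P (_ : [set x | _]%classic = [set` [fset tup f | f in A]%fset]%classic).
    by rewrite set_fsetK card_imfset //= -cardE.
  apply/seteqP; split=> x /=.
    move=> [eq_l].
    have lt_xN i : (tnth x i < N)%N.
      apply: leq_ltn_trans lt_lN; rewrite -eq_l (bigD1 i) //=.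
      by rewrite (leq_trans (leq_pmull _ (a_gt0 i))) // leq_addr.
    apply/imfsetP; exists [ffun i => Ordinal (lt_xN i)] => /=.
      rewrite inE -[in X in _ == X]eq_l; apply/eqP.
      by apply: eq_bigr => i _; rewrite ffunE.
    by apply: eq_from_tnth => i; rewrite tnth_mktuple ffunE.
  case/imfsetP => f /=; rewrite inE => /eqP <- ->.
  by congr Posz; apply: eq_bigr => i _; rewrite tnth_mktuple.
rewrite bigA_distr_bigA coef_sum -sum1_card natr_sum big_mkcond /=.
apply: eq_bigr => f _.
have -> : \prod_i 'X^(a i) ^+ f i = 'X^(\sum_i a i * f i) :> {poly int}.
  by rewrite expr_sum; apply: eq_bigr => i _; rewrite exprM.
by rewrite coefXn inE eq_sym; case: eqP.
Qed.

Theorem theorem4p1 (n : nat) (a : 'I_n -> nat) (b : nat)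
    (n_gt0 : (0 < n)%N) (a_gt0 : forall i : 'I_n, (0 < a i)%N) :
  \sum_(0 <= k < (\sum_(i < n) a i - n).+1)
      l' a k * (P a (b%:Z - k%:Z))%:Z
  = 'C(b + n.-1, n.-1)%:Z.
Proof.
set D := (_ - n).+1.
pose A := \prod_i geom ('X : {poly int}) (a i).
pose Q := \prod_i geom ('X^(a i) : {poly int}) b.+1.
pose F k := A`_k * (P a (b%:Z - k%:Z))%:Z.
under eq_bigr do rewrite l'E //.
(* Beyond D the factor of degree < D has no coefficient, and beyond b the
   argument of P is negative, so both ranges extend to their union. *)
have -> : \sum_(0 <= k < D) F k = \sum_(0 <= k < b.+1) F k.
  have F_geD k : (D <= k)%N -> F k = 0.
    move=> le_Dk; rewrite /F nth_default ?mul0r //.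
    exact: leq_trans (size_prod_geomX a_gt0) le_Dk.
  have F_gtb k : (b < k)%N -> F k = 0.
    by move=> lt_bk; rewrite /F P_neg ?mulr0 //; lia.
  transitivity (\sum_(0 <= k < D + b.+1) F k).
    rewrite [RHS](big_cat_nat _ (n := D)) ?leq_addr //= [X in _ + X]big_nat_cond.
    by rewrite [X in _ + X]big1 ?addr0 // => k /andP[/andP[/F_geD]].
  rewrite [LHS](big_cat_nat _ (n := b.+1)) ?leq_addl //= [X in _ + X]big_nat_cond.
  by rewrite [X in _ + X]big1 ?addr0 // => k /andP[/andP[/F_gtb]].
have -> : \sum_(0 <= k < b.+1) F k = (A * Q)`_b.
  rewrite coefM big_mkord; apply: eq_bigr => -[k le_kb] _ /=.
  by rewrite /F subzn // -P_nat ?natz // ltnS leq_subr.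
rewrite -big_split /=.
rewrite (@eq_modXn_prod _ b.+1 _ _ _ _ (fun=> geom 'X b.+1)) //; last first.
  by move=> i _; apply: geomX_mul_geomXn_mod.
by rewrite prodr_const card_ord -(prednK n_gt0) coef_geomX_exp //= natz addnC.
Qed.
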